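(* Let $G$ be an $n$-node digraph with independence number at most $\alpha$. For every $p\in\mathbb{N}$ there is a $p$-pass deterministic streaming algorithm that either correctly reports that $G$ is not strongly connected, or outputs a strongly connected spanning subgraph of $G$ whose number of arcs is at most twice that of a minimum spanning strong subgraph of $G$, using (a) $O(\alpha n^{1+1/p})$ space in the insertion-only model; and (b) $O(\alpha n^{1+O(1/\sqrt{p})})$ space in the turnstile model.
   Context: All digraphs are simple; the independence number is that of the underlying undirected graph. A minimum spanning strong subgraph of a strongly connected digraph $G$ is a spanning subgraph of $G$ that is strongly connected and has the minimum number of arcs among such subgraphs. Graph streaming model: arcs arrive in adversarial order, $p$ forward passes; insertion-only model has only insertions, turnstile allows deletions of previously inserted arcs. Space upper bounds are in words of $O(\log n)$ bits. *)

(* Defs.v *)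
From mathcomp Require Import all_boot all_order all_algebra.
From mathcomp Require Import reals exp.

Set Implicit Arguments.
Unset Strict Implicit.
Unset Printing Implicit Defensive.

Notation diarc n := ('I_n * 'I_n)%type.

(* An update (true, a) inserts the arc a, and (false, a) deletes it. *)
Notation update n := (bool * diarc n)%type.

Section Digraphs.
Variable n : nat.

(* A digraph on the nodes 'I_n is its arc set; antiparallel arcs are allowed,
   and parallel arcs are excluded by construction. *)
Definition digraph : Type := {set diarc n}.

Implicit Types G H F : digraph.

Definition simple_digraph G : bool := [forall u, (u, u) \notin G].

Definition adjacent G : rel 'I_n :=
  [rel u v | ((u, v) \in G) || ((v, u) \in G)].

Definition independent G (S : {set 'I_n}) : bool :=
  [forall u in S, forall v in S, ~~ adjacent G u v].

Definition independence_number G : nat :=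
  \max_(S : {set 'I_n} | independent G S) #|S|.

Definition strongly_connected G : bool :=
  [forall u, forall v, connect [rel x y | (x, y) \in G] u v].

Definition spanning_strong_subgraph G H : bool :=
  (H \subset G) && strongly_connected H.

Definition minimum_spanning_strong_subgraph G F : Prop :=
  spanning_strong_subgraph G F /\
  forall F', spanning_strong_subgraph G F' -> #|F| <= #|F'|.

(* None stands for the report "not strongly connected". *)
Definition correct_output G (o : option digraph) : Prop :=
  match o with
  | None => ~~ strongly_connected G
  | Some H =>
      spanning_strong_subgraph G H /\
      forall F, minimum_spanning_strong_subgraph G F -> #|H| <= 2 * #|F|
  end.

Definition insertion_only_stream G (s : seq (diarc n)) : Prop :=
  uniq s /\ s =i G.

Definition insertions (s : seq (update n)) (a : diarc n) : nat :=
  count_mem (true, a) s.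
Definition deletions (s : seq (update n)) (a : diarc n) : nat :=
  count_mem (false, a) s.

(* Only arcs that are currently present may be deleted, and what remains at the
   end of the stream is exactly the simple digraph G.  An arc may temporarily
   have multiplicity larger than one. *)
Definition turnstile_stream G (s : seq (update n)) : Prop :=
  [/\ forall b u v, (b, (u, v)) \in s -> u != v,
      forall k a, deletions (take k s) a <= insertions (take k s) a
    & forall a, insertions s a = deletions s a + (a \in G)].

End Digraphs.

Definition memory (words wordsize : nat) : Type :=
  words.-tuple (wordsize.-tuple bool).

(* The memory content is all that persists between two stream items and
   between two passes: in particular the index of the current pass is not
   available for free. *)
Record streaming_algorithm (words wordsize : nat) (item output : Type) :=
  StreamingAlgorithm {
    alg_init : memory words wordsize;
    alg_step : memory words wordsize -> item -> memory words wordsize;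
    alg_end_of_pass : memory words wordsize -> memory words wordsize;
    alg_output : memory words wordsize -> output }.

Section Run.
Variables (words wordsize : nat) (item output : Type).
Variable A : streaming_algorithm words wordsize item output.

Definition one_pass (s : seq item) (m : memory words wordsize) :=
  alg_end_of_pass A (foldl (alg_step A) m s).

Definition run (p : nat) (s : seq item) : output :=
  alg_output A (iter p (one_pass s) (alg_init A)).

End Run.

Definition insertion_only_solves (n alpha p words wordsize : nat)
    (A : streaming_algorithm words wordsize (diarc n) (option (digraph n))) : Prop :=
  forall G : digraph n, simple_digraph G -> independence_number G <= alpha ->
  forall s, insertion_only_stream G s -> correct_output G (run A p s).

Definition turnstile_solves (n alpha p words wordsize : nat)
    (A : streaming_algorithm words wordsize (update n) (option (digraph n))) : Prop :=
  forall G : digraph n, simple_digraph G -> independence_number G <= alpha ->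
  forall s, turnstile_stream G s -> correct_output G (run A p s).

(* Main.v *)
(** A union of an in-branching and an out-branching has fewer than 2n arcs, while
    a strong digraph on n >= 2 nodes has at least n arcs; hence it suffices to
    find a sparse subgraph H of G with the same reachability relation.

    Split the nodes into blocks of size g^i, and suppose that H_i has the
    reachability of G inside each block.  An antichain of this reachability
    preorder inside a block is an independent set of G, so by Dilworth's theorem
    each block is covered by alpha chains.  For a node v, a subblock of the next
    larger block of v and a chain of this subblock, only the first out-neighbour
    of v on the chain matters, which leaves n * g * alpha arcs to be found.
    Adding them to H_i and discarding redundant arcs yields H_(i+1): the arcs
    that leave u's strong component in an irredundant digraph have pairwise
    unreachable heads, so at most (alpha + 2) n arcs remain.

    In the insertion-only model the first out-neighbours are running minima, one
    pass per level, and g is about n^(1/p).  In the turnstile model they are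
    found by g^2-ary search on keys below n^2 with modular counters, using about
    sqrt p passes for each of about sqrt p levels. *)

Require Import Defs.
From mathcomp Require Import all_boot all_order all_algebra.
From mathcomp Require Import boolp reals exp zify ring lra.

Set Implicit Arguments.
Unset Strict Implicit.
Unset Printing Implicit Defensive.

Import Order.TTheory GRing.Theory Num.Theory.

(** * Dilworth's theorem for preorders *)

Section Preorder.
Variables (T : finType) (r : rel T).
Hypotheses (r_refl : reflexive r) (r_trans : transitive r).

(** This number never decreases going up the preorder, so it serves as an integer rank. *)
Definition nonabove_count (x : T) : nat := #|[set y | ~~ r x y]|.

Lemma nonabove_count_lt x : nonabove_count x < #|T|.
Proof.
rewrite -cardsT; apply: proper_card; rewrite properT.
by apply/negP=> /eqP/setP/(_ x); rewrite !inE r_refl.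
Qed.

(** If [r y x], the elements not above [y] are among those not above [x]. The cardinalities then
    make the two sets equal, and [y] is not in the first. *)
Lemma nonabove_count_le x y :
  r x y || r y x -> nonabove_count x <= nonabove_count y -> r x y.
Proof.
case/orP=> // ryx lexy.
have: [set z | ~~ r y z] == [set z | ~~ r x z].
  rewrite eqEcard lexy andbT.
  by apply/subsetP=> z; rewrite !inE; apply: contra; apply: r_trans.
by move/eqP/setP/(_ y); rewrite !inE r_refl => /esym/negbFE.
Qed.

Definition antichain (B : {set T}) : Prop :=
  {in B &, forall x y, r x y -> x = y}.

Definition chain_coloring (A : {set T}) (k : nat) (f : T -> nat) : Prop :=
  {in A, forall x, f x < k} /\
  {in A &, forall x y, f x = f y -> r x y || r y x}.

(** Colours are injective on an antichain, so [k] elements use up all [k] colours. *)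
Lemma antichain_color_surj (A B : {set T}) k f i :
    chain_coloring A k f -> B \subset A -> antichain B -> #|B| = k -> i < k ->
  exists2 x, x \in B & f x = i.
Proof.
move=> [f_lt f_chain] sBA aB cB lt_ik.
have injf : {in B &, injective f}.
  move=> x y xB yB eqf.
  have /orP[|] := f_chain x y (subsetP sBA _ xB) (subsetP sBA _ yB) eqf.
    exact: aB.
  by move/(aB _ _ yB xB).
have szB : size [seq f x | x <- enum B] = k by rewrite size_map -cardE.
have: i \in iota 0 k by rewrite mem_iota.
have [|||_ <-] := @uniq_min_size _ [seq f x | x <- enum B] (iota 0 k).
- rewrite map_inj_in_uniq ?enum_uniq // => x y.
  by rewrite !mem_enum; apply: injf.
- move=> y /mapP[x]; rewrite mem_enum => xB ->.
  by rewrite mem_iota /= add0n f_lt // (subsetP sBA).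
- by rewrite szB size_iota.
- by case/mapP=> x; rewrite mem_enum => xB ->; exists x.
Qed.

Lemma chain_coloring_add (A K : {set T}) k f :
    {in K &, forall x y, r x y || r y x} -> chain_coloring (A :\: K) k f ->
  exists f', chain_coloring A k.+1 f'.
Proof.
move=> chK [f_lt f_ch]; exists (fun x => if x \in K then k else f x); split.
  move=> x xA; case: ifPn => // xK.
  by rewrite ltnS ltnW // f_lt // inE xK.
move=> x y xA yA; case: ifPn => xK; case: ifPn => yK.
- by move=> _; apply: chK.
- by move=> ek; have := f_lt y; rewrite inE yK yA -ek ltnn => /(_ isT).
- by move=> ek; have := f_lt x; rewrite inE xK xA ek ltnn => /(_ isT).
- by apply: f_ch; rewrite inE ?xK ?yK.
Qed.

(* Galvin's proof of Dilworth's theorem. *)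
Theorem dilworth (A : {set T}) k :
    (forall B : {set T}, B \subset A -> antichain B -> #|B| <= k) ->
  exists f, chain_coloring A k f.
Proof.
elim: {A}#|A| {-2}A (leqnn #|A|) k => [|m IHm] A leAm k width.
  move: leAm; rewrite leqn0 cards_eq0 => /eqP->.
  by exists (fun=> 0); split=> x; rewrite inE.
case: (set_0Vmem A) => [->|[a0 a0A]].
  by exists (fun=> 0); split=> x; rewrite inE.
case: k width => [|k] width.
  have := width [set a0]; rewrite sub1set a0A cards1 ltnn => /(_ isT) H.
  by suff /H : antichain [set a0] by []; move=> x y; rewrite !inE => /eqP-> /eqP->.
(* Every element of [A] comparable to [a] lies below it. *)
have [a aA a_max] := @arg_maxnP _ a0 (fun x => x \in A) nonabove_count a0A.
(* If removing a chain through [a] destroys all antichains of size [k.+1], the rest needs [k]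
   colours and the chain takes the last one. *)
have removeK (K : {set T}) : a \in K -> {in K &, forall x y, r x y || r y x} ->
    (forall B : {set T}, B \subset A :\: K -> antichain B -> #|B| != k.+1) ->
    exists f, chain_coloring A k.+1 f.
  move=> aK chK noB.
  have [|B sB aB|f /(chain_coloring_add chK)//] := IHm (A :\: K) _ k.
    rewrite -ltnS; apply: leq_trans leAm; apply: proper_card.
    apply/properP; split; first exact: subsetDl.
    by exists a; rewrite // inE aK.
  rewrite -ltnS ltn_neqAle noB //=.
  by apply: width aB; apply: subset_trans sB _; apply: subsetDl.
pose big (B : {set T}) := [/\ B \subset A :\ a, antichain B & #|B| = k.+1].
have [[B0 bigB0]|nobig] := pselect (exists B, big B); last first.
  apply: (removeK [set a]); rewrite ?set11 //.
    by move=> x y; rewrite !inE => /eqP-> /eqP->; rewrite r_refl.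
  by move=> B sB aB; apply/eqP=> cB; apply: nobig; exists B.
have sA'A : A :\ a \subset A by apply: subsetDl.
have [||f f_col] := IHm (A :\ a) _ k.+1.
- by move: leAm; rewrite (cardsD1 a) aA.
- by move=> B sB aB; apply: width aB; apply: subset_trans sB _.
pose Q := [set z | `[< exists2 B, big B & z \in B >]].
have QP z : reflect (exists2 B, big B & z \in B) (z \in Q).
  by rewrite inE; apply: asboolP.
have Qsub z : z \in Q -> z \in A :\ a.
  by case/QP=> B [/subsetP sB _ _] /sB.
(* Among the elements of colour [i] that lie on an antichain of size [k.+1], a highest one is
   chosen. *)
have top i : i < k.+1 ->
    exists x, [/\ x \in Q, f x = i & forall z, z \in Q -> f z = i -> r z x].
  move=> lti; have [sB aB cB] := bigB0.
  have [x0 x0B fx0] := antichain_color_surj f_col sB aB cB lti.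
  have Px0 : (x0 \in Q) && (f x0 == i).
    by rewrite fx0 eqxx andbT; apply/QP; exists B0.
  have [x /andP[xQ /eqP fx] x_max] :=
    @arg_maxnP _ x0 (fun x => (x \in Q) && (f x == i)) nonabove_count Px0.
  exists x; split=> // z zQ fz; apply: nonabove_count_le.
    by apply: f_col.2; rewrite ?Qsub // fz.
  by apply: x_max; rewrite zQ fz /=.
have [x x_top] := choice (fun i : 'I_k.+1 => top i (ltn_ord i)).
have fx i : f (x i) = i by case: (x_top i).
have x_inj : injective x by move=> i j eqx; apply: val_inj; rewrite /= -!fx eqx.
(* The antichain through [x j] has an element of colour [i]; it is below [x i], hence below [x j],
   hence equal to [x j]. *)
have x_anti i j : r (x i) (x j) -> i = j.
  move=> rij; have [/QP[B [sB aB cB] xjB] _ _] := x_top j.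
  have [y yB fy] := antichain_color_surj f_col sB aB cB (ltn_ord i).
  have yxi : r y (x i) by case: (x_top i) => _ _; apply=> //; apply/QP; exists B.
  have eqy : y = x j by apply: aB => //; apply: r_trans rij.
  by apply: val_inj; rewrite /= -fy eqy fx.
have [/existsP[i rxa]|/existsPn incomp] := boolP [exists i, r (x i) a || r a (x i)].
  have {}rxa : r (x i) a.
    apply: nonabove_count_le => //; apply: a_max.
    by apply: (subsetP sA'A); apply: Qsub; case: (x_top i).
  (* A large antichain avoiding this chain would still have an element of colour [i]; being in [Q],
     it is below [x i] and so on the chain. *)
  apply: (removeK (a |: [set z in A :\ a | (f z == i) && r z (x i)])).
  - by rewrite setU11.
  - move=> y z; rewrite !in_setU1.
    case/orP=> [/eqP->|/setIdP[yA /andP[/eqP fy ry]]].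
      case/orP=> [/eqP->|/setIdP[_ /andP[_ rz]]]; first by rewrite r_refl.
      by rewrite (r_trans rz rxa) orbT.
    case/orP=> [/eqP->|/setIdP[zA /andP[/eqP fz rz]]].
      by rewrite (r_trans ry rxa).
    by apply: f_col.2; rewrite // fy fz.
  - move=> B sB aB; apply/eqP=> cB.
    have bigB : big B.
      split=> //; apply: subset_trans sB _.
      by apply: setDS; rewrite sub1set setU11.
    have [sBA' _ _] := bigB.
    have [z zB fz] := antichain_color_surj f_col sBA' aB cB (ltn_ord i).
    have zQ : z \in Q by apply/QP; exists B.
    have := subsetP sB z zB; rewrite in_setD in_setU1 inE (Qsub _ zQ) fz eqxx /=.
    by case: (x_top i) => _ _ -> //; rewrite orbT.
(* Now [a] and the [x i] form an antichain of size [k.+2], which exceeds the width. *)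
have aX : a \notin x @: setT.
  apply/imsetP=> -[i _ eqa]; have := incomp i.
  by rewrite eqa r_refl.
have := width (a |: x @: setT).
rewrite cardsU1 aX card_imset // cardsT card_ord ltnn => H.
suff : false by []; apply: H.
  rewrite subUset sub1set aA; apply/subsetP=> _ /imsetP[i _ ->].
  by apply: (subsetP sA'A); apply: Qsub; case: (x_top i).
move=> y z; rewrite !in_setU1.
case/orP=> [/eqP->|/imsetP[i _ ->]]; case/orP=> [/eqP->|/imsetP[j _ ->]] //.
- by move=> raj; have := incomp j; rewrite raj orbT.
- by move=> ria; have := incomp i; rewrite ria.
- by move/x_anti->.
Qed.

End Preorder.

(** * Sparse subgraphs with the same reachability *)

(** The parent of [v] is its predecessor on a shortest path from [rt v]. The second hypothesis keeps
    the root constant along the path, so the distance to it drops. *)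
Lemma branching (T : finType) (e : rel T) (rt : T -> T) :
    (forall v, connect e (rt v) v) ->
    (forall u v, connect e (rt v) u -> connect e u v -> rt u = rt v) ->
  exists p : T -> T,
    forall v, connect [rel x y | e x y && (x == p y)] (rt v) v.
Proof.
move=> rt_reach rt_eq.
pose D v m := [exists q : m.-tuple T, path e (rt v) q && (last (rt v) q == v)].
have exD v : exists m, D v m.
  have /connectP[q pq eqv] := rt_reach v.
  by exists (size q); apply/existsP; exists (in_tuple q); rewrite /= pq -eqv eqxx.
pose d v := ex_minn (exD v).
have step v : exists u, v != rt v -> [/\ e u v, rt u = rt v & d u < d v].
  have [->|ne] := eqVneq v (rt v); first by exists v.
  rewrite /d; case: ex_minnP => m /existsP[[q /= /eqP sz_q] /andP[]].
  case/lastP: q sz_q => [_ _ /eqP eqv|q w]; first by rewrite /= in eqv; rewrite eqv eqxx in ne.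
  rewrite size_rcons rcons_path last_rcons => sz_q /andP[pq ew] /eqP eqw _.
  rewrite eqw in ew.
  have eq_rt : rt (last (rt v) q) = rt v.
    by apply: rt_eq; [apply/connectP; exists q | apply: connect1].
  exists (last (rt v) q) => _; split=> //.
  case: ex_minnP => k _ /(_ (size q)); rewrite -sz_q ltnS; apply.
  apply/existsP; exists (in_tuple q) => /=.
  by rewrite eq_rt pq eqxx.
have [p pP] := choice step; exists p => v.
elim: {v}(d v) {-2}v (leqnn (d v)) => [|m IHm] v ledm.
all: have [<-|ne] := eqVneq v (rt v); first exact: connect0.
all: have [epv rtp ltd] := pP v ne.
  by move: ltd; rewrite ltnNge (leq_trans ledm).
apply: (@connect_trans _ _ (p v)); last by apply: connect1; rewrite /= epv eqxx.
by rewrite -rtp; apply: IHm; rewrite -ltnS (leq_trans ltd).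
Qed.

Section Sparsification.
Variable n : nat.
Implicit Types (E F G H : digraph n) (u v w x y : 'I_n).

Definition reach E : rel 'I_n := connect [rel x y | (x, y) \in E].

Lemma reach_sub E F :
  (forall a, a \in E -> reach F a.1 a.2) -> subrel (reach E) (reach F).
Proof. by move=> sEF; apply: connect_sub => x y /sEF. Qed.

Lemma reachS E F : E \subset F -> subrel (reach E) (reach F).
Proof.
move=> /subsetP sEF; apply: reach_sub => -[x y] /sEF xyF; exact: connect1.
Qed.

Lemma reach_arc E x y : (x, y) \in E -> reach E x y.
Proof. by move=> ?; apply: connect1. Qed.

Lemma reach_refl E : reflexive (reach E).
Proof. by move=> x; apply: connect0. Qed.

Lemma reach_trans E : transitive (reach E).
Proof. exact: connect_trans. Qed.

Definition reach_preserving E F : bool :=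
  (F \subset E) && [forall u, forall v, reach E u v ==> reach F u v].

Lemma reach_preservingP E F :
  reflect (F \subset E /\ forall a, a \in E -> reach F a.1 a.2)
          (reach_preserving E F).
Proof.
apply: (iffP andP) => [[sFE /forallP pr]|[sFE pr]]; split=> //.
  by case=> u v uvE; have /forallP/(_ v)/implyP := pr u; apply; apply: reach_arc.
by apply/forallP=> u; apply/forallP=> v; apply/implyP; apply: reach_sub.
Qed.

Definition sparsify E : digraph n :=
  [arg min_(F < E | reach_preserving E F) #|F|].

Lemma sparsify_preserving E : reach_preserving E (sparsify E).
Proof.
rewrite /sparsify; case: arg_minnP => //.
by apply/reach_preservingP; split=> // -[x y]; apply: reach_arc.
Qed.

Lemma sparsify_sub E : sparsify E \subset E.
Proof. by case/reach_preservingP: (sparsify_preserving E). Qed.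

Lemma reach_sparsify E : reach (sparsify E) =2 reach E.
Proof.
move=> u v; apply/idP/idP; first exact/reachS/sparsify_sub.
by apply: reach_sub; case/reach_preservingP: (sparsify_preserving E).
Qed.

Definition irredundant E : Prop :=
  forall a, a \in E -> ~~ reach (E :\ a) a.1 a.2.

Lemma sparsify_irredundant E : irredundant (sparsify E).
Proof.
move=> a; rewrite /sparsify; case: arg_minnP => [|F pF Fmin aF].
  by apply/reach_preservingP; split=> // -[x y]; apply: reach_arc.
apply/negP=> ra; have [sFE pr] := reach_preservingP _ _ pF.
have: reach_preserving E (F :\ a).
  apply/reach_preservingP; split; first exact: subset_trans (subsetDl _ _) sFE.
  move=> b /pr; apply: reach_sub => c cF.
  have [->//|neca] := eqVneq c a.
  by case: c cF neca => x y cF neca; apply: reach_arc; rewrite !inE neca.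
by move/Fmin; rewrite leqNgt [X in _ < X](cardsD1 a) aF ltnS leqnn.
Qed.

(* An in-branching together with an out-branching of each strong component
   already connects the component, so irredundancy leaves no other arc. *)
Lemma irredundant_component_arcs E :
  irredundant E -> #|[set a in E | reach E a.2 a.1]| <= 2 * n.
Proof.
move=> irrE.
pose scc u v := reach E u v && reach E v u.
have scc_sym u v : scc u v = scc v u by rewrite /scc andbC.
have scc_trans : transitive scc.
  move=> v u w /andP[uv vu] /andP[vw wv].
  by rewrite /scc (reach_trans uv vw) (reach_trans wv vu).
(* The choice depends only on the predicate, so [rt] is constant on each strong component. *)
pose rt v := odflt v [pick u | scc v u].
have sccrt v : scc v (rt v).
  rewrite /rt; case: pickP => //= _; by rewrite /scc reach_refl.
have rt_eq u v : scc u v -> rt u = rt v.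
  move=> uv; rewrite /rt (_ : [pick w | scc u w] = [pick w | scc v w]).
    by case: pickP => //= /(_ v); rewrite /scc reach_refl.
  apply: eq_pick => w; apply/idP/idP; apply: scc_trans => //.
  by rewrite scc_sym.
have reach_rt v : reach E v (rt v) by case/andP: (sccrt v).
have rt_reach v : reach E (rt v) v by case/andP: (sccrt v).
have [|p p_out] := @branching _ [rel x y | (x, y) \in E] rt rt_reach.
  move=> u v rvu ruv; apply: rt_eq; rewrite /scc [reach E u v]ruv.
  exact: reach_trans (reach_rt v) rvu.
have revE u v : connect [rel x y | (y, x) \in E] u v = reach E v u.
  by rewrite /reach connect_rev.
have [|u v|q q_in] := @branching _ [rel x y | (y, x) \in E] rt.
- by move=> v; rewrite revE.
- rewrite !revE => rur rvu; apply: rt_eq; rewrite /scc rvu andbT.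
  exact: reach_trans rur (rt_reach v).
(* At a root the parent pair need not be an arc, hence the intersection with [E]. *)
pose F := E :&: ([set (p v, v) | v in [set: 'I_n]] :|:
                 [set (v, q v) | v in [set: 'I_n]]).
have outF v : reach F (rt v) v.
  apply: connect_sub (p_out v) => x y /= /andP[xyE /eqP eqx].
  apply: reach_arc; rewrite !inE xyE; apply/orP; left.
  by apply/imsetP; exists y; rewrite ?eqx.
have inF v : reach F v (rt v).
  have := connect_rev [rel x y | ((y, x) \in E) && (x == q y)] v (rt v).
  rewrite /= q_in; apply: connect_sub => x y /= /andP[xyE /eqP eqy].
  apply: reach_arc; rewrite !inE xyE; apply/orP; right.
  by apply/imsetP; exists x; rewrite ?eqy.
have sub : [set a in E | reach E a.2 a.1] \subset F.
  apply/subsetP=> -[u v]; rewrite inE /= => /andP[uvE rvu].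
  (* An arc inside a component but outside [F] is bypassed in [F] through the root. *)
  apply/idPn=> nF; have /negP := irrE _ uvE; apply=> /=.
  have sFE : F \subset E :\ (u, v).
    apply/subsetP=> a aF; rewrite !inE; apply/andP; split.
      by apply: contraNneq nF => <-.
    by move: aF; rewrite inE => /andP[].
  apply: (reachS sFE); apply: reach_trans (inF u) _.
  by rewrite (@rt_eq u v) // /scc rvu andbT; apply: reach_arc.
apply: leq_trans (subset_leq_card sub) _.
apply: leq_trans (subset_leq_card (subsetIr _ _)) _.
rewrite mul2n -addnn; apply: leq_trans (leq_card_setU _ _) _.
by apply: leq_add; apply: leq_trans (leq_imset_card _ _) _; rewrite cardsT card_ord.
Qed.

(** If [v] reaches [w], the arc from [u] to [v] and a path onwards replace the arc [(u, w)]. That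
    path avoids [(u, w)] because [v] cannot reach [u]. *)
Lemma irredundant_leaving_antichain E u :
  irredundant E ->
  antichain (reach E) [set v | ((u, v) \in E) && ~~ reach E v u].
Proof.
move=> irrE v w; rewrite !inE => /andP[uvE nvu] /andP[uwE nwu] rvw.
apply/eqP; apply: contraT => nevw.
have /negP := irrE _ uwE; case=> /=.
apply: (@reach_trans _ v).
  by apply: reach_arc; rewrite !inE uvE andbT; apply: contraNneq nevw => -[->].
have /connectP[q pq eqw] := rvw.
apply/connectP; exists q => //.
elim: q v {uvE nevw} nvu rvw pq eqw => //= x q IHq v nvu rvw /andP[vx pq] eqw.
have nxu : ~~ reach E x u.
  by apply: contra nvu => rxu; apply: reach_trans (reach_arc vx) rxu.
rewrite !inE vx andbT IHq //; last by apply/connectP; exists q.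
by rewrite andbT; apply: contraNneq nvu => -[-> _]; apply: reach_refl.
Qed.

(** Arcs inside strong components number at most [2 * n]; the others are counted by their tails. *)
Lemma irredundant_card E k :
    irredundant E ->
    (forall u, #|[set v | ((u, v) \in E) && ~~ reach E v u]| <= k) ->
  #|E| <= (k + 2) * n.
Proof.
move=> irrE out_k.
rewrite -(cardsID [set a | reach E a.2 a.1] E) mulnDl addnC; apply: leq_add.
  have: \sum_(u in 'I_n) #|[set v | ((u, v) \in E) && ~~ reach E v u]| <= k * n.
    rewrite -[X in _ <= _ * X](card_ord n) mulnC -sum_nat_const.
    by apply: leq_sum => u _; apply: out_k.
  apply: leq_trans.
  rewrite -sum1_card (partition_big (fun a => a.1) predT) //=.
  apply: leq_sum => u _; rewrite sum1_card.
  rewrite -(card_imset _ (f := fun v => (u, v))) => [|v w [] //].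
  apply: subset_leq_card; apply/subsetP=> -[x y].
  rewrite unfold_in /= !inE /= => /andP[/andP[nr xyE] /eqP eqx].
  by apply/imsetP; exists y; rewrite ?inE -?eqx ?xyE.
by apply: leq_trans (irredundant_component_arcs irrE); rewrite setIdE.
Qed.

Lemma strongly_connectedP E :
  reflect (forall u v, reach E u v) (strongly_connected E).
Proof.
apply: (iffP forallP) => [H u v|H u]; first exact: (forallP (H u) v).
by apply/forallP=> v; apply: H.
Qed.

Lemma irredundant_strong_card E :
  irredundant E -> strongly_connected E -> #|E| <= 2 * n.
Proof.
move=> irrE /strongly_connectedP strE.
apply: leq_trans (irredundant_component_arcs irrE); apply: subset_leq_card.
by apply/subsetP=> a aE; rewrite inE aE /=; apply: strE.
Qed.

Lemma strong_card_ge E : 1 < n -> strongly_connected E -> n <= #|E|.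
Proof.
move=> n_gt1 /strongly_connectedP strE.
rewrite -[X in X <= _](card_ord n) -cardsT.
suff sub : [set: 'I_n] \subset [set a.1 | a in E].
  exact: leq_trans (subset_leq_card sub) (leq_imset_card _ _).
apply/subsetP=> u _.
have [v neuv] : exists v, v != u.
  have := n_gt1; rewrite -[X in 1 < X](card_ord n) (cardD1 u) inE /= ltnS.
  by case/card_gt0P=> v; rewrite !inE andbT; exists v.
have /connectP[[|x q] /= ] := strE u v; first by move=> _ eqv; rewrite eqv eqxx in neuv.
by move=> /andP[uxE _] _; apply/imsetP; exists (u, x).
Qed.

End Sparsification.

(** * From one level to the next *)

Section MinTable.
Variables (X S : finType) (N : nat) (phi : X -> option S) (key : X -> 'I_N).

Definition min_table (G : {set X}) (t : {ffun S -> option 'I_N}) : Prop :=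
  forall s, match t s with
  | None => forall x, x \in G -> phi x <> Some s
  | Some m =>
      (exists x, [/\ x \in G, phi x = Some s & key x = m]) /\
      forall x, x \in G -> phi x = Some s -> m <= key x
  end.

Definition min_insert (t : {ffun S -> option 'I_N}) (x : X) :=
  if phi x is Some s then
    [ffun s' => if s' == s then
                  Some (if t s is Some m then if key x < m then key x else m
                        else key x)
                else t s']
  else t.

Lemma min_insertP G t x : min_table G t -> min_table (x |: G) (min_insert t x).
Proof.
move=> tG s; rewrite /min_insert; case phix: (phi x) => [s'|]; last first.
  have := tG s; case: (t s) => [m [[y [yG py ky]] mle]|no].
    split; first by exists y; rewrite in_setU1 yG orbT.
    by move=> z; rewrite in_setU1 => /orP[/eqP->|/mle//]; rewrite phix.
  by move=> z; rewrite in_setU1 => /orP[/eqP->|/no//]; rewrite phix.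
rewrite ffunE; case: eqP => [->|ne].
  have := tG s'; case: (t s') => [m [[y [yG py ky]] mle]|no].
    case: ltnP => ltm; split.
    - by exists x; rewrite setU11.
    - move=> z; rewrite in_setU1 => /orP[/eqP->//|zG pz].
      by apply: leq_trans (ltnW ltm) _; apply: mle.
    - by exists y; rewrite in_setU1 yG orbT.
    - by move=> z; rewrite in_setU1 => /orP[/eqP->//|]; apply: mle.
  split; first by exists x; rewrite setU11.
  by move=> z; rewrite in_setU1 => /orP[/eqP->//|zG /(no z zG)].
have nes : Some s' <> Some s by case=> /esym.
have := tG s; case: (t s) => [m [[y [yG py ky]] mle]|no].
  split; first by exists y; rewrite in_setU1 yG orbT.
  by move=> z; rewrite in_setU1 => /orP[/eqP->|/mle//]; rewrite phix.
by move=> z; rewrite in_setU1 => /orP[/eqP->|/no//]; rewrite phix.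
Qed.

Lemma min_insert_foldl (s : seq X) (G : {set X}) :
  s =i G -> min_table G (foldl min_insert [ffun=> None] s).
Proof.
move=> sG; have -> : G = [set x in s] by apply/setP=> x; rewrite inE sG.
elim/last_ind: s {sG} => [|s x IHs] /=.
  by move=> u; rewrite ffunE => x; rewrite inE.
rewrite foldl_rcons (_ : [set y in rcons s x] = x |: [set y in s]).
  exact: min_insertP.
by apply/setP=> y; rewrite !inE mem_rcons inE.
Qed.

End MinTable.

Section Levels.
Variables (n a g' : nat).
Local Notation g := g'.+1.
Implicit Types (G H : digraph n) (u v w : 'I_n).

(** Blocks are intervals of [g ^ i] consecutive nodes, and singletons at level 0. *)
Definition block (i : nat) (v : 'I_n) : nat := v %/ g ^ i.

Lemma block_divn i v : block i.+1 v = block i v %/ g.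
Proof. by rewrite /block expnSr divnMA. Qed.

Definition block_certificate i G H : Prop :=
  [/\ H \subset G,
      forall u v, (u, v) \in H -> block i u = block i v
    & forall u v, (u, v) \in G -> block i u = block i v -> reach H u v].

(** An arc of [G] inside [B] would make its ends comparable in [H], hence equal; so [B] is
    independent in the loopless [G]. *)
Lemma antichain_card_le i G H k (B : {set 'I_n}) :
    simple_digraph G -> independence_number G <= k -> block_certificate i G H ->
    {in B &, forall u v, block i u = block i v} -> antichain (reach H) B ->
  #|B| <= k.
Proof.
move=> /forallP simG indG [_ _ certH] blockB antiB.
apply: leq_trans indG; rewrite /independence_number.
apply: (leq_bigmax_cond (F := fun S : {set 'I_n} => #|S|)).
have nG u v : u \in B -> v \in B -> (u, v) \notin G.
  move=> uB vB; apply/negP=> uvG.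
  have eqr := antiB _ _ uB vB (certH _ _ uvG (blockB _ _ uB vB)).
  by have := simG u; rewrite {2}eqr uvG.
apply/forallP=> u; apply/implyP=> uB; apply/forallP=> v; apply/implyP=> vB.
by rewrite /adjacent /= negb_or !nG.
Qed.

Definition block_coloring H i (f : {ffun 'I_n -> 'I_a.+1}) : bool :=
  [forall u, forall v, (block i u == block i v) && (f u == f v) ==>
     reach H u v || reach H v u].

(** Being a function of [H] and [i], the colouring occupies no memory. *)
Definition coloring H i : {ffun 'I_n -> 'I_a.+1} :=
  odflt [ffun=> ord0] [pick f | block_coloring H i f].

Lemma coloringP i G H u v :
    simple_digraph G -> independence_number G <= a.+1 ->
    block_certificate i G H ->
    block i u = block i v -> coloring H i u = coloring H i v ->
  reach H u v || reach H v u.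
Proof.
move=> simG indG certH eqb; rewrite /coloring; case: pickP => [f|no _] /=.
  move=> /forallP/(_ u)/forallP/(_ v)/implyP Hf eqf.
  by apply: Hf; rewrite eqb eqf !eqxx.
(* Dilworth's theorem is applied in each block separately; the colourings glue, since only nodes of
   one block are compared. *)
have exf c : exists f, chain_coloring (reach H) [set w | block i w == c] a.+1 f.
  apply: dilworth; [exact: reach_refl | exact: reach_trans | move=> B sB].
  apply: (antichain_card_le simG indG certH) => x y xB yB.
  have := subsetP sB y yB; have := subsetP sB x xB.
  by rewrite !inE => /eqP-> /eqP->.
have [f f_col] := choice exf.
have /negP[] := negbT (no [ffun w => inord (f (block i w) w)]).
apply/forallP=> x; apply/forallP=> y; apply/implyP=> /andP[/eqP eqxy].
have [ltf chf] := f_col (block i y).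
rewrite !ffunE eqxy => /eqP/(congr1 val) /=.
have xA : x \in [set w | block i w == block i y] by rewrite inE eqxy.
have yA : y \in [set w | block i w == block i y] by rewrite inE.
by rewrite !inordK; [exact: chf | exact: ltf | exact: ltf].
Qed.

Definition slot : finType := ('I_n * 'I_g * 'I_a.+1)%type.

(** The index of a subblock modulo [g] is its position inside the next larger block. *)
Definition arc_slot H i (e : diarc n) : option slot :=
  if block i.+1 e.1 == block i.+1 e.2
  then Some (e.1, inZp (block i e.2), coloring H i e.2) else None.

Lemma arc_key_subproof H v : nonabove_count (reach H) v * n + v < n * n.
Proof.
have := nonabove_count_lt (@reach_refl _ H) v; rewrite card_ord => ltr.
apply: leq_trans (leq_mul ltr (leqnn n)).
by rewrite mulSn addnC -addSn leq_add2r.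
Qed.

(* The remainder modulo n makes the key determine the head of the arc. *)
Definition arc_key H (e : diarc n) : 'I_(n * n) :=
  Ordinal (arc_key_subproof H e.2).

Lemma arc_key_mod H e : arc_key H e %% n = e.2.
Proof. by rewrite /= modnMDl modn_small. Qed.

Lemma arc_key_div H e : arc_key H e %/ n = nonabove_count (reach H) e.2.
Proof.
have n_gt0 : 0 < n by case: e.2 => m /(leq_ltn_trans (leq0n m)).
by rewrite /= divnMDl // divn_small // addn0.
Qed.

(** The slot fixes the tail and the key fixes the head, so arcs can be recovered from a table of
    keys. *)
Lemma arc_slot_key_inj H i e e' s :
  arc_slot H i e = Some s -> arc_slot H i e' = Some s ->
  arc_key H e = arc_key H e' -> e = e'.
Proof.
rewrite /arc_slot; case: ifP => // _ [<-]; case: ifP => // _ [eq1 _ _] eqk.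
rewrite [e]surjective_pairing [e']surjective_pairing eq1; congr pair.
by apply: val_inj; rewrite /= -(arc_key_mod H e) eqk arc_key_mod.
Qed.

Definition add_minima H i (t : {ffun slot -> option 'I_(n * n)}) : digraph n :=
  H :|: [set e | if arc_slot H i e is Some s then t s == Some (arc_key H e)
                 else false].

Definition next_certificate H i t : digraph n := sparsify (add_minima H i t).

(** An arc [(u, v)] of [G] is replaced by the arc from [u] kept in its slot, with some head [w], and
    a path of [H] from [w] to [v]: both nodes are on one chain and [w] has no larger rank. *)
Lemma next_certificateP i G H t :
    simple_digraph G -> independence_number G <= a.+1 ->
    block_certificate i G H -> min_table (arc_slot H i) (arc_key H) G t ->
  block_certificate i.+1 G (next_certificate H i t).
Proof.
move=> simG indG certH tG; have [sHG blockH reachH] := certH.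
have sub := sparsify_sub (add_minima H i t).
split.
- apply: subset_trans sub _; rewrite subUset sHG; apply/subsetP=> e.
  rewrite inE; case es: (arc_slot H i e) => [s|//] /eqP ts.
  have := tG s; rewrite ts => -[[e' [e'G es' eqk]] _].
  by rewrite (arc_slot_key_inj es es').
- move=> u v /(subsetP sub); rewrite !inE => /orP[/blockH eqb|].
    by rewrite !block_divn eqb.
  by rewrite /arc_slot /=; case: ifP => // /eqP.
move=> u v uvG eqb; rewrite reach_sparsify.
have es : arc_slot H i (u, v) = Some (u, inZp (block i v), coloring H i v).
  by rewrite /arc_slot /= eqb eqxx.
have := tG (u, inZp (block i v), coloring H i v).
case ts: (t _) => [m|]; last by move/(_ _ uvG)/(_ es).
case=> -[[x w] [xwG es' keyw]] /(_ _ uvG es) lekey.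
move: (es'); rewrite /arc_slot /=; case: ifP => // /eqP eqb' [eqx eqz eqc].
have eqwv : block i w = block i v.
  rewrite (divn_eq (block i w) g) (divn_eq (block i v) g) -!block_divn.
  by rewrite -eqb' -eqb eqx eqz.
have xwA : reach (add_minima H i t) x w.
  by apply: reach_arc; rewrite !inE es' ts keyw eqxx orbT.
rewrite -eqx; apply: reach_trans xwA _.
apply: (reachS (subsetUl _ _)).
apply: nonabove_count_le; [exact: reach_refl | exact: reach_trans | |].
  exact: coloringP certH eqwv eqc.
(* Division by [n] turns the comparison of keys into one of ranks. *)
rewrite -(arc_key_div H (x, w)) -(arc_key_div H (u, v)) leq_div2r // keyw.
exact: lekey.
Qed.

(** The heads of arcs that leave the component of [u] form an antichain within one block, so each
    tail has at most [a.+1] such arcs. *)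
Lemma certificate_card i G H :
    simple_digraph G -> independence_number G <= a.+1 ->
    block_certificate i G H -> irredundant H -> #|H| <= 3 * a.+1 * n.
Proof.
move=> simG indG certH irrH; have [_ blockH _] := certH.
apply: (@leq_trans ((a.+1 + 2) * n)); last by rewrite leq_mul2r; lia.
apply: irredundant_card => // u.
apply: (antichain_card_le simG indG certH).
  by move=> v w; rewrite !inE => /andP[/blockH<- _] /andP[/blockH<- _].
exact: irredundant_leaving_antichain.
Qed.

Lemma empty_certificate G : block_certificate 0 G set0.
Proof.
split=> [|u v|u v _]; rewrite ?sub0set ?inE //.
by rewrite /block expn0 !divn1 => /val_inj->; apply: reach_refl.
Qed.

Lemma block_top i v : n <= g ^ i -> block i v = 0.
Proof. by move=> len; rewrite /block divn_small // (leq_trans _ len). Qed.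

Definition certificate_output H : option (digraph n) :=
  if strongly_connected H then Some (sparsify H) else None.

(** The factor 2 compares at most [2 * n] arcs after sparsification with the [n] arcs of any strong
    digraph. The top level is a single block, so a strong [G] makes [H] strong. *)
Lemma certificate_outputP i G H :
    1 < n -> n <= g ^ i -> block_certificate i G H ->
  correct_output G (certificate_output H).
Proof.
move=> n_gt1 top [sHG _ reachH]; rewrite /certificate_output.
case: ifPn => [strH|] /=.
  have strS : strongly_connected (sparsify H).
    apply/strongly_connectedP=> u v; rewrite reach_sparsify.
    exact/strongly_connectedP.
  split; first by rewrite /spanning_strong_subgraph strS (subset_trans (sparsify_sub H)).
  move=> F [/andP[_ strF] _].
  apply: leq_trans (irredundant_strong_card (@sparsify_irredundant _ H) strS) _.
  by rewrite leq_mul2l strong_card_ge.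
apply: contra => /strongly_connectedP strG; apply/strongly_connectedP=> u v.
by apply: reach_sub (strG u v) => -[x y] xyG; apply: reachH; rewrite ?block_top.
Qed.

End Levels.

(** * Search for minimal keys in turnstile streams *)

Section Search.
Variables (X S : finType) (N b' k Q : nat).
Variables (phi : X -> option S) (key : X -> 'I_N).
Local Notation b := b'.+1.
Local Notation counter := 'I_Q.+2.
Hypotheses (key_range : N <= b ^ k) (cardX : #|X| < Q.+2).

(** These are the [r] leading digits of a [k]-digit key in base [b]. *)
Definition key_prefix (r : nat) (x : X) : nat := key x %/ b ^ (k - r).

Lemma key_prefixS r x : r < k -> key_prefix r x = key_prefix r.+1 x %/ b.
Proof. by move=> ltrk; rewrite /key_prefix -divnMA -expnSr subnSK. Qed.

Lemma key_prefix0 x : key_prefix 0 x = 0.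
Proof. by rewrite /key_prefix subn0 divn_small // (leq_trans _ key_range). Qed.

(* The table holds the leading base-b digits of the minimal keys; a slot is
   only known to be nonempty after the first round. *)
Definition prefix_table (G : {set X}) r (t : {ffun S -> option 'I_N}) : Prop :=
  forall s, match t s with
  | None => forall x, x \in G -> phi x <> Some s
  | Some m =>
      (0 < r -> exists x, [/\ x \in G, phi x = Some s & key_prefix r x = m]) /\
      forall x, x \in G -> phi x = Some s -> m <= key_prefix r x
  end.

(** The empty prefix has value 0; [insub] fails only for [N = 0], and then [X] is empty. *)
Definition search_init : {ffun S -> option 'I_N} := [ffun=> insub 0].

Lemma search_initP G : prefix_table G 0 search_init.
Proof.
move=> s; rewrite ffunE; case: insubP => [m _ eqm|]; first by rewrite eqm.
by move=> no x; case: (key x) no => m /(leq_ltn_trans (leq0n m)) ->.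
Qed.

(** Only elements that extend the known prefix of their slot are counted, according to their next
    digit. *)
Definition search_cell r (t : {ffun S -> option 'I_N}) (x : X) : option (S * 'I_b) :=
  if phi x is Some s then
    if t s is Some m then
      if key_prefix r.+1 x %/ b == m then Some (s, inZp (key_prefix r.+1 x))
      else None
    else None
  else None.

Definition search_next (t : {ffun S -> option 'I_N})
    (cnt : {ffun S * 'I_b -> counter}) : {ffun S -> option 'I_N} :=
  [ffun s => if t s is Some m then
     if [pick y | (cnt (s, y) != 0%R) &&
                  [forall z, (cnt (s, z) != 0%R) ==> (y <= z)]] is Some y
     then insub (m * b + y) else None
   else None].

Definition detects (G : {set X}) r t (cnt : {ffun S * 'I_b -> counter}) : Prop :=
  forall c, cnt c != 0%R <-> exists2 x, x \in G & search_cell r t x = Some c.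

(** The least digit with a nonzero counter continues the minimum; a larger prefix stays larger
    whatever digit follows. *)
Lemma search_nextP G r t cnt :
    r < k -> prefix_table G r t -> detects G r t cnt ->
  prefix_table G r.+1 (search_next t cnt).
Proof.
move=> ltrk tG det s; rewrite ffunE.
have := tG s; case ts: (t s) => [m|//] [ex_m min_m].
have cellE x : phi x = Some s -> key_prefix r x = m ->
    search_cell r t x = Some (s, inZp (key_prefix r.+1 x)).
  by move=> px eqm; rewrite /search_cell px ts -key_prefixS // eqm eqxx.
case: pickP => [y /andP[nzy /forallP min_y]|no].
  have [x xG] := (det _).1 nzy.
  rewrite /search_cell; case px: (phi x) => [s'|//]; case ts': (t s') => [m'|//].
  case: eqP => // eqm [eqs eqy]; subst s'.
  have {ts'} eqmm : m' = m by move: ts'; rewrite ts => -[].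
  rewrite eqmm in eqm.
  have eqv : key_prefix r.+1 x = m * b + y.
    by rewrite {1}(divn_eq (key_prefix r.+1 x) b) eqm -eqy.
  rewrite insubT => [|lt]; first by rewrite -eqv (leq_ltn_trans (leq_div _ _)).
  split=> [_|z zG pz]; first by exists x.
  rewrite /=; have := min_m z zG pz.
  rewrite leq_eqVlt => /orP[/eqP eqz|].
    have := cellE _ pz (esym eqz) => cz.
    have := min_y (inZp (key_prefix r.+1 z)).
    have -> /= : cnt (s, inZp (key_prefix r.+1 z)) != 0%R by apply/det; exists z.
    rewrite (divn_eq (key_prefix r.+1 z) b) -key_prefixS // -eqz leq_add2l.
    by rewrite modnMDl modn_mod.
  rewrite key_prefixS // => ltm.
  rewrite (divn_eq (key_prefix r.+1 z) b); apply: leq_trans (leq_addr _ _).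
  by apply: leq_trans (leq_mul ltm (leqnn b)); rewrite mulSn addnC leq_add2r ltnW.
(* In a nonempty slot some element has prefix [m], by the table if [0 < r] and because all prefixes
   vanish if [r = 0]. Its counter would be nonzero. *)
move=> x0 x0G px0.
have [x [xG px eqm]] : exists x, [/\ x \in G, phi x = Some s & key_prefix r x = m].
  case: (posnP r) => [r0|/ex_m//]; exists x0; split=> //.
  have := min_m _ x0G px0; rewrite r0 key_prefix0 leqn0 => /eqP-> //.
pose y0 : 'I_b := inZp (key_prefix r.+1 x).
have nz0 : cnt (s, y0) != 0%R by apply/det; exists x; rewrite ?cellE.
have [y nzy min_y] := @arg_minnP _ y0 (fun y => cnt (s, y) != 0%R) val nz0.
have := no y; rewrite nzy /= => /negbT/negP; apply.
by apply/forallP=> z; apply/implyP; apply: min_y.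
Qed.

Lemma prefix_table_min G t : 0 < k -> prefix_table G k t -> min_table phi key G t.
Proof.
move=> k_gt0 tG s; have := tG s; case: (t s) => [m|//] [/(_ k_gt0) ex_m min_m].
have prefE x : key_prefix k x = key x by rewrite /key_prefix subnn divn1.
split.
  have [x [xG px eqm]] := ex_m; exists x; split=> //.
  by apply: val_inj; rewrite /= -eqm prefE.
by move=> x xG px; rewrite -prefE; apply: min_m.
Qed.

Definition count_update r t (cnt : {ffun S * 'I_b -> counter}) (u : bool * X) :
    {ffun S * 'I_b -> counter} :=
  [ffun c => (cnt c + (if search_cell r t u.2 == Some c
                       then if u.1 then 1 else -1 else 0))%R].

Lemma sum_count (U : finType) (V : zmodType) (f : U -> V) (s : seq U) :
  (\sum_(u <- s) f u = \sum_(u : U) f u *+ count_mem u s)%R.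
Proof.
elim: s => [|v s IHs]; first by rewrite big_nil big1.
rewrite big_cons IHs /= [RHS](eq_bigr (fun u => f u *+ (v == u) + f u *+ count_mem u s)%R).
  rewrite big_split /=; congr (_ + _)%R.
  rewrite (bigD1 v) //= eqxx mulr1n big1 ?addr0 // => u neuv.
  by rewrite eq_sym (negbTE neuv).
by move=> u _; rewrite mulrnDr.
Qed.

(** Insertions and deletions cancel up to membership in [G], so a counter ends as the size of its
    cell modulo [Q.+2]. That size is at most [#|X|], hence survives the reduction; wrapping around
    during the stream is harmless. *)
Lemma count_updateP (G : {set X}) r t (s : seq (bool * X)) :
    (forall x, count_mem (true, x) s = count_mem (false, x) s + (x \in G)) ->
  detects G r t (foldl (count_update r t) [ffun=> 0%R] s).
Proof.
move=> sG c.
have -> : (foldl (count_update r t) [ffun=> 0] s c =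
           #|[set x in G | search_cell r t x == Some c]|%:R)%R.
  pose f (u : bool * X) : counter :=
    (if search_cell r t u.2 == Some c then if u.1 then 1 else -1 else 0)%R.
  have -> : (foldl (count_update r t) [ffun=> 0] s c = \sum_(u <- s) f u)%R.
    have gen (cnt : {ffun S * 'I_b -> counter}) :
        (foldl (count_update r t) cnt s c = cnt c + \sum_(u <- s) f u)%R.
      elim: s cnt {sG} => [|u s IHs] cnt /=; first by rewrite big_nil addr0.
      by rewrite IHs ffunE big_cons addrA.
    by rewrite gen ffunE add0r.
  rewrite sum_count -(pair_bigA _ (fun d x => f (d, x) *+ count_mem (d, x) s)%R) /=.
  rewrite big_bool /= -big_split /= -sum1_card natr_sum [RHS]big_mkcond /=.
  apply: eq_bigr => x _; rewrite inE sG /f /=.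
  case: eqP => _ /=; last by rewrite andbF !mul0rn addr0.
  rewrite andbT mulrnDr mulNrn addrC addKr.
  by case: (x \in G).
have lt : #|[set x in G | search_cell r t x == Some c]| < Q.+2.
  exact: leq_ltn_trans (max_card _) cardX.
rewrite Zp_nat -val_eqE /= modn_small // -lt0n; split.
  by case/card_gt0P=> x; rewrite inE => /andP[xG /eqP cx]; exists x.
by case=> x xG cx; apply/card_gt0P; exists x; rewrite inE xG cx eqxx.
Qed.

End Search.

(** * Streaming algorithms *)

(** States embed injectively into memory contents. Contents that encode no state decode to [init],
    but never occur in a run. *)
Lemma finite_state_algorithm (S : finType) (words wordsize : nat)
    (item output : Type) (init : S) (step : S -> item -> S) (fin : S -> S)
    (out : S -> output) :
    #|S| <= 2 ^ (wordsize * words) ->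
  exists A : streaming_algorithm words wordsize item output,
    forall p s, run A p s = out (iter p (fun m => fin (foldl step m s)) init).
Proof.
move=> leS.
have le_mem : #|S| <= #|{: words.-tuple (wordsize.-tuple bool)}|.
  by rewrite !card_tuple card_bool -expnM.
pose enc (x : S) : memory words wordsize := enum_val (widen_ord le_mem (enum_rank x)).
have enc_inj : injective enc.
  by move=> x y /enum_val_inj/(congr1 val)/= /val_inj/enum_rank_inj.
pose dec (m : memory words wordsize) : S := odflt init [pick x | enc x == m].
have encK : cancel enc dec.
  move=> x; rewrite /dec; case: pickP => [y /eqP/enc_inj//|/(_ x)].
  by rewrite eqxx.
exists (StreamingAlgorithm (enc init) (fun m e => enc (step (dec m) e))
         (fun m => enc (fin (dec m))) (fun m => out (dec m))) => p s.
rewrite /run /=; congr out.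
suff -> : iter p (one_pass (StreamingAlgorithm (enc init)
    (fun m e => enc (step (dec m) e)) (fun m => enc (fin (dec m)))
    (fun m => out (dec m))) s) (enc init) =
  enc (iter p (fun m => fin (foldl step m s)) init) by rewrite encK.
elim: p => //= p ->; rewrite /one_pass /=; congr (enc (fin _)).
suff -> x : foldl (fun m e => enc (step (dec m) e)) (enc x) s = enc (foldl step x s).
  by rewrite encK.
by elim: s x => //= e s IHs x; rewrite encK.
Qed.

Section SetCode.
Variables (X : finType) (M : nat).

(** A set of at most [M] elements thus takes [M] words instead of one bit per element of [X]. *)
Definition set_code : finType := {ffun 'I_M -> option X}.

Definition set_of_code (c : set_code) : {set X} := [set x | Some x \in codom c].

Definition code_of_set (E : {set X}) : set_code :=
  [ffun i : 'I_M => nth None (map Some (enum E)) i].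

Lemma code_of_setK (E : {set X}) : #|E| <= M -> set_of_code (code_of_set E) = E.
Proof.
move=> leEM; apply/setP=> x; rewrite inE; apply/codomP/idP => [[i]|xE].
  rewrite ffunE; case: (ltnP i (size (enum E))) => [lti|gei].
    by rewrite (nth_map x) // => -[->]; rewrite -mem_enum mem_nth.
  by rewrite nth_default // size_map.
have lti : index x (enum E) < M.
  by apply: leq_trans leEM; rewrite cardE index_mem mem_enum.
exists (Ordinal lti); rewrite ffunE /= (nth_map x) ?index_mem ?mem_enum //.
by rewrite nth_index // mem_enum.
Qed.

End SetCode.

Section Algorithms.
Variables (n a g' : nat).
Local Notation g := g'.+1.
Local Notation M := (3 * a.+1 * n).
Local Notation slot := (slot n a g').
Local Notation arc_slot' := (@arc_slot n a g').
Local Notation table := {ffun slot -> option 'I_(n * n)}.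
Local Notation cert c := (@set_of_code (diarc n) M c).

Hypotheses (n_gt1 : 1 < n) (g_gt1 : 1 < g).

(** The cap keeps the level within one word; level [n] is already a single block, as
    [n <= g ^ n]. *)
Definition next_level (i : 'I_n.+1) : 'I_n.+1 := inord (minn i.+1 n).

Lemma val_next_level i : next_level i = minn i.+1 n :> nat.
Proof. by rewrite inordK // ltnS geq_minr. Qed.

Lemma expn_n_ge : n <= g ^ n. Proof. exact/ltnW/ltn_expl. Qed.

Lemma next_level_certificate G (i : 'I_n.+1) H t :
    simple_digraph G -> independence_number G <= a.+1 ->
    block_certificate g' i G H -> min_table (arc_slot' H i) (arc_key H) G t ->
  block_certificate g' (next_level i) G
    (cert (code_of_set M (@next_certificate n a g' H i t))).
Proof.
move=> simG indG certH tG.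
have certS := next_certificateP simG indG certH tG.
rewrite code_of_setK; last first.
  by apply: certificate_card simG indG certS _; apply: sparsify_irredundant.
rewrite val_next_level; have [lti|lei] := ltnP i n.
  by rewrite (minn_idPl lti).
rewrite (minn_idPr (leqW lei)).
case: certS => sub bl re; split=> // u v uv.
- by rewrite !block_top ?expn_n_ge.
- move=> _; apply: re => //; rewrite !block_top //.
  all: by apply: leq_trans expn_n_ge _; rewrite leq_exp2l // ltnW.
Qed.

Definition ins_state : finType := ('I_n.+1 * set_code (diarc n) M * table)%type.

Definition ins_step (m : ins_state) (e : diarc n) : ins_state :=
  let: (i, c, t) := m in
  (i, c, min_insert (arc_slot' (cert c) i) (arc_key (cert c)) t e).

Definition ins_end (m : ins_state) : ins_state :=
  let: (i, c, t) := m in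
  (next_level i, code_of_set M (next_certificate (cert c) i t), [ffun=> None]).

Definition ins_init : ins_state := (ord0, code_of_set M set0, [ffun=> None]).

Definition ins_out (m : ins_state) := certificate_output (cert m.1.2).

Lemma ins_correct G p s :
    simple_digraph G -> independence_number G <= a.+1 ->
    insertion_only_stream G s -> n <= g ^ minn p n ->
  correct_output G
    (ins_out (iter p (fun m => ins_end (foldl ins_step m s)) ins_init)).
Proof.
move=> simG indG [_ sG] top.
(* Invariant: each pass raises the level by one, up to [n], and leaves the table empty. *)
suff [i [c [-> eqi certc]]] : exists i c,
    [/\ iter p (fun m => ins_end (foldl ins_step m s)) ins_init = (i, c, [ffun=> None]),
        i = minn p n :> nat & block_certificate g' i G (cert c)].
  by apply: certificate_outputP certc; rewrite ?eqi.
elim: p {top} => [|p [i [c [iterE eqi certc]]]].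
  exists ord0, (code_of_set M set0); rewrite min0n; split=> //.
  rewrite code_of_setK ?cards0 //; exact: empty_certificate.
have foldE (t : table) : foldl ins_step (i, c, t) s =
    (i, c, foldl (min_insert (arc_slot' (cert c) i) (arc_key (cert c))) t s).
  by elim: s t {sG iterE} => //= e s IHs t.
rewrite iterS iterE foldE /=; eexists _, _; split; first by [].
  by rewrite val_next_level eqi; lia.
by apply: next_level_certificate => //; apply: min_insert_foldl.
Qed.

Variable k : nat.
Hypotheses (k_gt0 : 0 < k) (k_le_n : k <= n) (gk_ge : n <= g ^ k).

Local Notation b' := (g ^ 2).-1.
Local Notation counts := {ffun slot * 'I_b'.+1 -> 'I_(n * n).+2}.

(** Base [g ^ 2] is chosen so that [k] digits cover the keys below [n * n], given that [g ^ k] is at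
    least [n]. *)
Lemma key_range : n * n <= b'.+1 ^ k.
Proof. by rewrite prednK ?expn_gt0 // -expnM mulnC expnM -mulnn leq_mul. Qed.

Lemma card_diarc : #|{: diarc n}| < (n * n).+2.
Proof. by rewrite card_prod card_ord. Qed.

Definition turn_state : finType :=
  ('I_n.+1 * 'I_n.+1 * set_code (diarc n) M * table * counts)%type.

Definition turn_step (m : turn_state) (u : update n) : turn_state :=
  let: (i, r, c, t, cnt) := m in
  (i, r, c, t,
   count_update k (arc_slot' (cert c) i) (arc_key (cert c)) r t cnt u).

Definition turn_end (m : turn_state) : turn_state :=
  let: (i, r, c, t, cnt) := m in
  let t' := search_next t cnt in
  if r.+1 == k then
    (next_level i, ord0, code_of_set M (next_certificate (cert c) i t'),
     search_init _ _, [ffun=> 0%R])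
  else (i, inord r.+1, c, t', [ffun=> 0%R]).

Definition turn_init : turn_state :=
  (ord0, ord0, code_of_set M set0, search_init _ _, [ffun=> 0%R]).

Definition turn_out (m : turn_state) := certificate_output (cert m.1.1.2).

Lemma turn_correct G p s :
    simple_digraph G -> independence_number G <= a.+1 ->
    turnstile_stream G s -> k * k <= p ->
  correct_output G
    (turn_out (iter p (fun m => turn_end (foldl turn_step m s)) turn_init)).
Proof.
move=> simG indG [_ _ sG] lekp.
(* Invariant: [p] passes complete [p %/ k] levels, capped at [n], and [p %% k] digits of the current
   search. Hence [k * k] passes suffice for [k] levels. *)
suff [i [r [c [t [-> eqi _ certc _]]]]] : exists (i r : 'I_n.+1) c t,
    [/\ iter p (fun m => turn_end (foldl turn_step m s)) turn_init
          = (i, r, c, t, [ffun=> 0%R]),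
        i = minn (p %/ k) n :> nat, r = p %% k :> nat,
        block_certificate g' i G (cert c)
      & prefix_table b' k (arc_slot' (cert c) i) (arc_key (cert c)) G r t].
  apply: certificate_outputP certc => //; apply: leq_trans gk_ge _.
  by rewrite leq_exp2l // eqi leq_min k_le_n andbT leq_divRL.
elim: p {lekp} => [|p [i [r [c [t [iterE eqi eqr certc tG]]]]]].
  exists ord0, ord0, (code_of_set M set0), (search_init _ _).
  rewrite div0n mod0n min0n; split=> //; last exact: search_initP.
  rewrite code_of_setK ?cards0 //; exact: empty_certificate.
have foldE (cnt : counts) : foldl turn_step (i, r, c, t, cnt) s =
    (i, r, c, t,
     foldl (count_update k (arc_slot' (cert c) i) (arc_key (cert c)) r t) cnt s).
  by elim: s cnt {sG iterE} => //= e s IHs cnt.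
have ltrk : r < k by rewrite eqr ltn_mod.
have := search_nextP key_range ltrk tG
  (@count_updateP _ _ _ b' k _ (arc_slot' (cert c) i) (arc_key (cert c))
     card_diarc G r t s sG).
rewrite iterS iterE foldE /=; set t' := search_next _ _ => t'G.
have eqp : p = p %/ k * k + r by rewrite eqr -divn_eq.
case: eqP => eqrk.
  have eqp1 : p.+1 = (p %/ k).+1 * k by rewrite mulSn {1}eqp -addnS eqrk addnC.
  eexists _, _, _, _; split; first by [].
  - by rewrite val_next_level eqi eqp1 mulnK //; lia.
  - by rewrite eqp1 modnMl.
  - apply: next_level_certificate => //; apply: (@prefix_table_min _ _ _ b' k) => //.
    by move: t'G; rewrite eqrk.
  - exact: search_initP.
have ltr1 : r.+1 < k by rewrite ltn_neqAle; apply/andP; split=> //; apply/eqP.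
have [divp modp] : p.+1 %/ k = p %/ k /\ p.+1 %% k = r.+1.
  have -> : p.+1 = p %/ k * k + r.+1 by rewrite addnS -eqp.
  by rewrite divnMDl // modnMDl (modn_small ltr1) (divn_small ltr1) addn0.
eexists _, _, _, _; split; first by [].
- by rewrite divp.
- by rewrite inordK ?modp // ltnS (leq_trans (ltnW ltr1)).
- by [].
- by rewrite inordK // ltnS (leq_trans (ltnW ltr1)).
Qed.

End Algorithms.

(** * Memory words needed for the states *)

Section StateSize.
Variables (n a g' : nat).
Local Notation g := g'.+1.
Local Notation W := (2 ^ (3 * up_log 2 n)).
Hypothesis n_gt1 : 1 < n.

(** For [n >= 2] this follows from [n * n + 2 <= n ^ 3]. A word then holds a level, an optional arc,
    an optional key or a counter. *)
Lemma word_ge : (n * n).+2 <= W.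
Proof.
have le_n : n <= 2 ^ up_log 2 n by apply: up_logP.
rewrite mulnC expnM; apply: (@leq_trans (n ^ 3)); last by rewrite leq_exp2r.
by rewrite !expnS expn0; nia.
Qed.

Lemma card_level : #|'I_n.+1| <= W.
Proof. by apply: leq_trans word_ge; rewrite card_ord; nia. Qed.

Lemma card_arc_option : #|{: option (diarc n)}| <= W.
Proof.
by apply: leq_trans (ltnW word_ge); rewrite card_option card_prod card_ord.
Qed.

Lemma card_key_option : #|{: option 'I_(n * n)}| <= W.
Proof. by apply: leq_trans (ltnW word_ge); rewrite card_option card_ord. Qed.

Lemma card_slot : #|slot n a g'| = a.+1 * n * g.
Proof. by rewrite !card_prod !card_ord mulnC mulnA. Qed.

Lemma ins_state_card :
  #|ins_state n a g'| <= 2 ^ (3 * up_log 2 n * (5 * (a.+1 * n * g))).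
Proof.
rewrite 2!card_prod !card_ffun card_slot [X in _ ^ X]card_ord [2 ^ _]expnM.
set s := a.+1 * n * g; set M := 3 * a.+1 * n.
(* One word for the level, [M] for the certificate and [s] for the table. *)
have le_words : 1 + M + s <= 5 * s by rewrite /s /M; nia.
have W_gt0 : 0 < W by rewrite expn_gt0.
apply: leq_trans (leq_pexp2l W_gt0 le_words).
rewrite 2!expnD expn1; apply: leq_mul; first apply: leq_mul.
- exact: card_level.
- by rewrite leq_exp2r ?card_arc_option // /M; nia.
- by rewrite leq_exp2r ?card_key_option // /s; nia.
Qed.

Lemma turn_state_card :
  #|turn_state n a g'| <= 2 ^ (3 * up_log 2 n * (7 * (a.+1 * n * g ^ 3))).
Proof.
rewrite 4!card_prod !card_ffun [#|{: _ * 'I_((g ^ 2).-1.+1)}|]card_prod card_slot.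
rewrite ![#|'I_(_ * n)|]card_ord [#|'I_(_.-1.+1)|]card_ord prednK ?expn_gt0 // [2 ^ _]expnM.
set s := a.+1 * n * g; set M := 3 * a.+1 * n.
have -> : a.+1 * n * g ^ 3 = s * g ^ 2 by rewrite /s (expnS _ 2) mulnA.
have g2_gt0 : 0 < g ^ 2 by rewrite expn_gt0.
(* Two words for the level and the digit, [M] for the certificate, [s] for the prefixes, and a
   counter for each slot and digit. *)
have le_words : 1 + 1 + M + s + s * g ^ 2 <= 7 * (s * g ^ 2).
  have: 1 + 1 + M + s <= 6 * s by rewrite /s /M; nia.
  by nia.
have W_gt0 : 0 < W by rewrite expn_gt0.
apply: leq_trans (leq_pexp2l W_gt0 le_words).
rewrite 4!expnD expn1; apply: leq_mul; first apply: leq_mul; first apply: leq_mul;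
  first apply: leq_mul.
- exact: card_level.
- exact: card_level.
- by rewrite leq_exp2r ?card_arc_option // /M; nia.
- by rewrite leq_exp2r ?card_key_option // /s; nia.
- by rewrite leq_exp2r ?card_ord ?word_ge // /s; nia.
Qed.

End StateSize.

(** * Choice of the parameters and final space bounds *)

Lemma exists_branching_factor n q : 1 < n -> 0 < q ->
  exists g', [/\ 0 < g', n <= g'.+1 ^ minn q n & g' ^ q < n].
Proof.
move=> n_gt1 q_gt0; have [lenq|ltqn] := leqP n q.
  by exists 1; rewrite exp1n; split=> //; apply/ltnW/ltn_expl.
have exg : exists g, n <= g ^ q.
  by exists n; rewrite -{1}(expn1 n) leq_pexp2l // ltnW.
(* The least [g] with [n <= g ^ q] is taken, so that its predecessor violates the inequality. *)
case: (ex_minnP exg) => g leg ming.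
case: g leg ming => [|[|g]] leg ming.
- by move: leg; rewrite exp0n // leqNgt ltnW.
- by move: leg; rewrite exp1n leqNgt n_gt1.
by exists g.+1; split=> //; rewrite ltnNge; apply/negP=> /ming; rewrite ltnn.
Qed.

Lemma exists_floor_sqrt p : 0 < p -> exists q, [/\ 0 < q, q * q <= p & p < q.+1 * q.+1].
Proof.
move=> p_gt0; pose P q := q * q <= p.
have P1 : P 1 by rewrite /P mul1n.
have bound q : P q -> q <= p by rewrite /P; nia.
case: (ex_maxnP (ex_intro P 1 P1) bound) => q Pq maxq; exists q; split=> //.
  exact: maxq.
by rewrite ltnNge; apply/negP=> /maxq; rewrite ltnn.
Qed.

Local Open Scope ring_scope.

(** Here [g'] is below the [q]-th root of [n], and [g'.+1 <= 2 * g']. *)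
Lemma branching_factor_le (R : realType) n q g' : (1 < n)%N -> (0 < q)%N ->
  (0 < g')%N -> (g' ^ q < n)%N -> (g'.+1)%:R <= 2 * n%:R `^ (q%:R^-1) :> R.
Proof.
move=> n_gt1 q_gt0 g_gt0 ltg.
have leg : g'%:R <= n%:R `^ (q%:R^-1) :> R.
  have -> : g'%:R = ((g' ^ q)%:R `^ (q%:R^-1)) :> R.
    rewrite natrX -powR_mulrn ?ler0n // -powRrM divff ?powRr1 ?ler0n //.
    by rewrite pnatr_eq0 -lt0n.
  apply: ge0_ler_powR; rewrite ?nnegrE ?invr_ge0 ?ler0n //.
  by rewrite ler_nat ltnW.
apply: le_trans (_ : 2 * g'%:R <= _); last by rewrite ler_pM2l.
by rewrite -natrM ler_nat; lia.
Qed.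

Lemma powR_split (R : realType) n (x : R) : (1 < n)%N ->
  n%:R `^ (1 + x) = n%:R * n%:R `^ x :> R.
Proof.
move=> n_gt1; rewrite powRD ?powRr1 ?ler0n //.
by apply/implyP=> _; rewrite pnatr_eq0 -lt0n ltnW.
Qed.

(** For [alpha = 0] the bound allows no words, and for [n <= 1] words have no bits; both cases call
    for an algorithm without memory. *)
Lemma trivial_algorithm n item : exists A : streaming_algorithm 0 0 item (option (digraph n)),
  forall p s, run A p s = Some set0.
Proof.
have [|A AE] := @finite_state_algorithm unit 0 0 item _ tt (fun m _ => m) id
  (fun=> Some (set0 : digraph n)); first by rewrite card_unit.
by exists A => p s; rewrite AE.
Qed.

Lemma trivial_correct n alpha (G : digraph n) :
    (alpha == 0%N) || (n <= 1)%N -> simple_digraph G ->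
    (independence_number G <= alpha)%N ->
  correct_output G (Some set0).
Proof.
move=> triv /forallP simG indG.
have small : (n <= 1)%N.
  case/orP: triv => // /eqP a0; rewrite leqNgt; apply/negP=> n_gt1.
  move: indG; rewrite a0 leqNgt => /negP; apply.
  pose u : 'I_n := Ordinal (ltnW n_gt1).
  apply: (@leq_trans #|[set u]|); first by rewrite cards1.
  apply: (leq_bigmax_cond (F := fun S : {set 'I_n} => #|S|)).
  apply/forallP=> x; apply/implyP=> /set1P->.
  apply/forallP=> y; apply/implyP=> /set1P->.
  by rewrite /adjacent /= negb_or !simG.
split; last by move=> F _; rewrite cards0.
rewrite /spanning_strong_subgraph sub0set; apply/strongly_connectedP=> u v.
have -> : u = v by apply: val_inj => /=; have := ltn_ord u; have := ltn_ord v; lia.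
exact: reach_refl.
Qed.

Theorem theorem6p9 (R : realType) :
  (exists (C : R) (K : nat), forall p n alpha : nat, (0 < p)%N ->
     exists (words wordsize : nat)
            (A : streaming_algorithm words wordsize (diarc n) (option (digraph n))),
       [/\ words%:R <= C * (alpha%:R * n%:R `^ (1 + 1 / p%:R)),
           (wordsize <= K * up_log 2 n)%N
         & insertion_only_solves alpha p A])
  /\
  (exists (C c : R) (K : nat), forall p n alpha : nat, (0 < p)%N ->
     exists (words wordsize : nat)
            (A : streaming_algorithm words wordsize (update n) (option (digraph n))),
       [/\ words%:R <= C * (alpha%:R * n%:R `^ (1 + c / Num.sqrt p%:R)),
           (wordsize <= K * up_log 2 n)%N
         & turnstile_solves alpha p A]).
Proof.
split.
  (* [10 = 5 * 2]: five words per slot, and [g] is at most twice the [p]-th root of [n]. *)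
  exists 10, 3 => p n alpha p_gt0.
  have [triv|] := boolP ((alpha == 0%N) || (n <= 1)%N).
    have [A AE] := trivial_algorithm n (diarc n).
    exists 0, 0, A; split=> //; first by rewrite !mulr_ge0 ?powR_ge0.
    by move=> G simG indG s _; rewrite AE; apply: trivial_correct indG.
  rewrite negb_or -ltnNge => /andP[alpha_gt0 n_gt1].
  case: alpha alpha_gt0 => // a _.
  have [g' [g'_gt0 top ltg]] := exists_branching_factor n_gt1 p_gt0.
  have [A AE] := finite_state_algorithm (ins_init n a g') (@ins_step n a g')
    (@ins_end n a g') (@ins_out n a g') (ins_state_card a g' n_gt1).
  exists (5 * (a.+1 * n * g'.+1))%N, (3 * up_log 2 n)%N, A; split=> //.
    have leg := branching_factor_le R n_gt1 p_gt0 g'_gt0 ltg.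
    rewrite powR_split // div1r !natrM.
    apply: le_trans (_ : 5 * (a.+1%:R * n%:R * (2 * n%:R `^ p%:R^-1)) <= _).
      by rewrite ler_wpM2l // ler_wpM2l // mulr_ge0.
    by rewrite le_eqVlt; apply/orP; left; apply/eqP; ring.
  by move=> G simG indG s sG; rewrite AE; apply: ins_correct.
(* [56 = 7 * 8], with 8 from the cube of the factor 2 in the bound on [g]; the 6 comes from
   [3 / q <= 6 / sqrt p]. *)
exists 56, 6, 3 => p n alpha p_gt0.
have [triv|] := boolP ((alpha == 0%N) || (n <= 1)%N).
  have [A AE] := trivial_algorithm n (update n).
  exists 0, 0, A; split=> //; first by rewrite !mulr_ge0 ?powR_ge0.
  by move=> G simG indG s _; rewrite AE; apply: trivial_correct indG.
rewrite negb_or -ltnNge => /andP[alpha_gt0 n_gt1].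
case: alpha alpha_gt0 => // a _.
have [q [q_gt0 leqp ltpq]] := exists_floor_sqrt p_gt0.
have [g' [g'_gt0 top ltg]] := exists_branching_factor n_gt1 q_gt0.
pose k := minn q n.
have k_gt0 : (0 < k)%N by rewrite leq_min q_gt0 ltnW.
have k_le_n : (k <= n)%N by apply: geq_minr.
have lekp : (k * k <= p)%N by apply: leq_trans leqp; apply: leq_mul; apply: geq_minl.
have [A AE] := finite_state_algorithm (turn_init n a g') (@turn_step n a g' k)
  (@turn_end n a g' k) (@turn_out n a g') (turn_state_card a g' n_gt1).
exists (7 * (a.+1 * n * g'.+1 ^ 3))%N, (3 * up_log 2 n)%N, A; split=> //.
  have leg := branching_factor_le R n_gt1 q_gt0 g'_gt0 ltg.
  set x := n%:R `^ q%:R^-1 in leg.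
  have x_ge0 : 0 <= x by apply: powR_ge0.
  have le3 : (g'.+1)%:R ^+ 3 <= 8 * x ^+ 3 :> R.
    have -> : 8 * x ^+ 3 = (2 * x) ^+ 3 by rewrite exprMn -natrX.
    by rewrite lerXn2r ?nnegrE ?mulr_ge0 ?ler0n.
  have lex : x ^+ 3 <= n%:R `^ (6 / Num.sqrt p%:R).
    rewrite /x -powR_mulrn ?powR_ge0 // -powRrM; apply: ler_powR.
      by rewrite ler1n ltnW.
    have sq_gt0 : 0 < Num.sqrt (p%:R : R) by rewrite sqrtr_gt0 ltr0n.
    (* Since [1 <= q], one has [p < (q + 1) ^ 2 <= (2 * q) ^ 2]. *)
    have lesq : Num.sqrt (p%:R : R) <= 2 * q%:R.
      have -> : 2 * q%:R = Num.sqrt ((2 * q%:R) ^+ 2) :> R.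
        by rewrite sqrtr_sqr ger0_norm // mulr_ge0.
      by rewrite ler_sqrt -natrM -natrX ?ler0n // ler_nat -mulnn; nia.
    rewrite mulrC ler_pdivlMr // mulrAC ler_pdivrMr ?ltr0n //.
    by lra.
  rewrite powR_split // 3!natrM natrX.
  apply: le_trans (_ : 7 * (a.+1%:R * n%:R * (8 * n%:R `^ (6 / Num.sqrt p%:R))) <= _).
    rewrite ler_wpM2l // ler_wpM2l ?mulr_ge0 //.
    by apply: le_trans le3 _; rewrite ler_pM2l.
  by rewrite le_eqVlt; apply/orP; left; apply/eqP; ring.
by move=> G simG indG s sG; rewrite AE; apply: turn_correct.
Qed.
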